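(* Let $F \in \mathbb{Z}[x,y]$ be a polynomial of total degree $6$, and let $F_6$ be its homogeneous part of degree $6$. Suppose that $F_6$ is square-free as a polynomial over an algebraic closure $\overline{\mathbb{Q}}$ of $\mathbb{Q}$ (i.e. $F_6$ is not divisible in $\overline{\mathbb{Q}}[x,y]$ by the square of a non-constant binary form). Then $F$ is not arithmetically complete.
   Context: A polynomial $F(x,y) \in \mathbb{Z}[x,y]$ is called arithmetically complete if there exist a positive integer $D_1$ and an integer $D_2$ such that $F(\mathbb{Z}^2) = D_1 \mathbb{Z}_{\geq 0} + D_2 = \{D_1 m + D_2 : m \in \mathbb{Z}, m \geq 0\}$. A binary form is a homogeneous polynomial in two variables. *)

(* Defs.v *)
From mathcomp Require Import all_boot all_order all_algebra all_field.
From mathcomp Require Import mpoly.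

Set Implicit Arguments.
Unset Strict Implicit.
Unset Printing Implicit Defensive.

Import GRing.Theory Num.Theory.
Local Open Scope ring_scope.

Definition eval2 (R : comNzRingType) (F : {mpoly R[2]}) (x y : R) : R :=
  F.@[tnth [tuple x; y]].

Definition arithmetically_complete (F : {mpoly int[2]}) : Prop :=
  exists D1 D2 : int, 0 < D1 /\
    forall k : int,
      (exists x y : int, eval2 F x y = k) <->
      (exists m : int, 0 <= m /\ k = D1 * m + D2).

(* [algC] is MathComp's algebraic closure of [rat]. The bound on [msize]
   (one plus the total degree, and 0 for the zero polynomial) says that [q]
   is nonzero and non-constant. *)
Definition squarefree_form (G : {mpoly int[2]}) : Prop :=
  forall q : {mpoly algC[2]},
    q \is homog mdeg -> (1 < msize q)%N ->
    ~ exists r : {mpoly algC[2]},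
        map_mpoly (intr : int -> algC) G = q ^+ 2 * r.

(* Main.v *)
(* A positive proportion of the integers of a half-line would have to be values
   of [F].  Being bounded below, [F] has a leading form that is nonnegative on
   Z^2; a real linear factor of that form would then occur to an even power, so
   a square-free [F_6] has no real linear factor at all.  Over the algebraic
   numbers it is thus a product of six factors [x - z y] with [z] non-real, each
   bounded below by a multiple of [|x| + |y|], so that
   [|F(x, y)| >= (|x| + |y|)^5] for [|x| + |y|] large.  Then values of size at
   most [B^5] come from at most [(2 B + 1)^2] integer points, which is too few. *)
Require Import Defs.
From mathcomp Require Import all_boot all_order all_algebra all_field.
From mathcomp Require Import mpoly zify ring.

Set Implicit Arguments.
Unset Strict Implicit.
Unset Printing Implicit Defensive.
Import Order.TTheory GRing.Theory Num.Theory.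
Local Open Scope ring_scope.

(** * Binary forms as homogenized polynomials in one variable *)

(* A homogenization of [p] only when [size p <= n.+1]: the coefficients of
   degree above [n] are dropped. *)
Definition hform (S : comNzRingType) (n : nat) (p : {poly S}) (x y : S) : S :=
  \sum_(i < n.+1) p`_i * (x ^+ i * y ^+ (n - i)).

Lemma rmorph_hform (S T : comNzRingType) (f : {rmorphism S -> T}) n
    (p : {poly S}) (x y : S) :
  f (hform n p x y) = hform n (map_poly f p) (f x) (f y).
Proof.
rewrite rmorph_sum /=; apply: eq_bigr => i _.
by rewrite coef_map /= !rmorphM !rmorphXn.
Qed.

Lemma hformMX (S : comNzRingType) n (p : {poly S}) (x y : S) :
  hform n.+1 (p * 'X) x y = x * hform n p x y.
Proof.
rewrite /hform big_ord_recl coefMX /= mul0r add0r big_distrr /=.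
by apply: eq_bigr => i _; rewrite coefMX /= subSS exprS; ring.
Qed.

Lemma hformS (S : comNzRingType) n (p : {poly S}) (x y : S) :
  (size p <= n.+1)%N -> hform n.+1 p x y = y * hform n p x y.
Proof.
move=> sp; rewrite /hform big_ord_recr /= nth_default // mul0r addr0.
rewrite big_distrr /=; apply: eq_bigr => i _.
by rewrite subSn ?leq_ord // exprS; ring.
Qed.

Lemma hformD (S : comNzRingType) n (p q : {poly S}) (x y : S) :
  hform n (p + q) x y = hform n p x y + hform n q x y.
Proof. by rewrite /hform -big_split; apply: eq_bigr => i _; rewrite coefD mulrDl. Qed.

Lemma hformCM (S : comNzRingType) n c (p : {poly S}) (x y : S) :
  hform n (c%:P * p) x y = c * hform n p x y.
Proof. by rewrite /hform big_distrr; apply: eq_bigr => i _; rewrite coefCM -mulrA. Qed.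

Lemma hformMXsubC (S : comNzRingType) n a (p : {poly S}) (x y : S) :
  (size p <= n.+1)%N ->
  hform n.+1 (p * ('X - a%:P)) x y = (x - a * y) * hform n p x y.
Proof.
move=> sp; rewrite mulrBr hformD hformMX -mulrN -polyCN [p * _]mulrC hformCM.
by rewrite hformS //; ring.
Qed.

Lemma hform_prod_XsubC (S : comNzRingType) (c : S) (s : seq S) (x y : S) :
  hform (size s) (c *: \prod_(z <- s) ('X - z%:P)) x y =
  c * \prod_(z <- s) (x - z * y).
Proof.
elim: s => [|z s IHs].
  by rewrite !big_nil /hform big_ord1 coefZ coef1 /= !mulr1.
rewrite !big_cons [X in c *: X]mulrC scalerAl hformMXsubC ?IHs; first by rewrite mulrCA.
by rewrite (leq_trans (size_scale_leq _ _)) ?size_prod_XsubC.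
Qed.

Lemma hform_horner (K : fieldType) n (p : {poly K}) (x y : K) :
  (size p <= n.+1)%N -> y != 0 -> hform n p x y = y ^+ n * p.[x / y].
Proof.
move=> sp y0; rewrite (horner_coef_wide _ sp) big_distrr /=.
apply: eq_bigr => i _; rewrite [RHS]mulrCA; congr (_ * _).
have -> : y ^+ n = y ^+ (n - i) * y ^+ i by rewrite -exprD subnK ?leq_ord.
by rewrite expr_div_n; field; rewrite expf_neq0.
Qed.

(** Reversing the coefficients moves the point at infinity to the point 0. *)
Lemma hform_swap (K : comNzRingType) n (p : {poly K}) (x y : K) :
  hform n p x y = hform n (\poly_(i < n.+1) p`_(n - i)) y x.
Proof.
rewrite /hform (reindex_inj rev_ord_inj) /=; apply: eq_bigr => i _.
by rewrite coef_poly ltn_ord subSS subKn ?leq_ord // [_ * x ^+ _]mulrC.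
Qed.

Lemma dhomog_hform (R : comNzRingType) n (G : {mpoly R[2]}) :
  G \is n.-homog ->
  exists2 g : {poly R}, (size g <= n.+1)%N &
    G = hform n (map_poly (@mpolyC 2 R) g) 'X_ord0 'X_ord_max.
Proof.
move=> /dhomogP hG.
have lift01 : lift ord0 ord0 = ord_max :> 'I_2 by apply: val_inj.
pose mon i := [multinom [tuple i; n - i]%N].
exists (\poly_(i < n.+1) G@_(mon i)); first exact: size_poly.
have monE (i : 'I_n.+1) :
    'X_ord0 ^+ i * 'X_ord_max ^+ (n - i) = 'X_[R, mon i] :> {mpoly R[2]}.
  by rewrite [RHS]mpolyXE_id big_ord_recl big_ord1 lift01 !multinomE !(tnth_nth 0%N).
transitivity (\sum_(i < n.+1) G@_(mon i) *: 'X_[R, mon i]); last first.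
  rewrite /hform; apply: eq_bigr => i _.
  by rewrite -monE coef_map coef_poly ltn_ord /= mul_mpolyC.
(* In degree [n] the exponent [m ord0] determines [m]; in any other degree homogeneity makes the
   coefficient vanish. *)
apply/mpolyP => m; rewrite raddf_sum /=.
under eq_bigr => i _ do rewrite mcoeffZ mcoeffX.
have mdeg2 (k : 'X_{1..2}) : mdeg k = (k ord0 + k ord_max)%N.
  by rewrite mdegE big_ord_recl big_ord1 lift01.
have [dm|dm] := eqVneq (mdeg m) n; last first.
  rewrite memN_msupp_eq0 => [|]; last by apply: contra dm => /hG/eqP.
  rewrite big1 // => i _; have [eq_m|] := eqVneq; last by rewrite mulr0.
  case/eqP: dm; rewrite -eq_m mdeg2 !multinomE !(tnth_nth 0%N) /=.
  by rewrite subnKC ?leq_ord.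
have lt_m0 : (m ord0 < n.+1)%N by rewrite ltnS -dm mdeg2 leq_addr.
have mon_m : mon (m ord0) = m.
  apply/mnmP => j; rewrite multinomE (tnth_nth 0%N) /= -{1}dm mdeg2 addKn.
  by case: j => -[|[|]] // lt_j; congr (m _); apply: val_inj.
rewrite (bigD1 (Ordinal lt_m0)) //= mon_m eqxx mulr1 big1 ?addr0 // => i ne_i.
have [eq_m|] := eqVneq; last by rewrite mulr0.
by case/eqP: ne_i; apply: val_inj; rewrite /= -eq_m multinomE (tnth_nth 0%N).
Qed.

(** * Lower bounds for products of non-real linear factors *)

(** Put w = x - z y. As x and y are real and z is not, the imaginary part of w controls y, and then
    x = w + z y is controlled too. *)
Lemma nonreal_linear_lower_bound (C : numClosedFieldType) (z : C) :
  z \isn't Num.real ->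
  exists2 e : C, 0 < e & {in Num.real &, forall x y,
    e * (`|x| + `|y|) <= `|x - z * y|}.
Proof.
move=> z_nreal; have d_gt0 : 0 < `|z - z^*|.
  rewrite normr_gt0 subr_eq0 eq_sym; apply: contra z_nreal => /eqP zE.
  exact/CrealP.
(* [k] is the factor of |w| obtained by adding [d] times [xw] to |z| + 1 times [dy]. *)
set d := `|z - z^*| in d_gt0; set k := d + 2 * (`|z| + 1).
have z1_gt0 : 0 < `|z| + 1 by rewrite ltr_wpDl.
have k_gt0 : 0 < k by rewrite addr_gt0 // mulr_gt0.
exists (d / k) => [|x y xR yR]; first by rewrite divr_gt0.
rewrite mulrAC ler_pdivrMr //.
set w := x - z * y.
have dy : d * `|y| <= 2 * `|w|.
  have -> : d * `|y| = `|w - w^*|.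
    rewrite -normrM distrC; congr `|_|.
    by rewrite /w rmorphB rmorphM /= (conj_Creal xR) (conj_Creal yR); ring.
  by rewrite (le_trans (ler_normB _ _)) // norm_conjC mulrDl !mul1r.
have xw : `|x| <= `|w| + `|z| * `|y|.
  by rewrite -normrM -[X in `|X| <= _](subrK (z * y)) ler_normD.
have -> : `|w| * k = d * `|w| + (`|z| + 1) * (2 * `|w|) by rewrite /k; ring.
have -> : d * (`|x| + `|y|) = d * (`|x| - `|z| * `|y|) + (`|z| + 1) * (d * `|y|).
  by ring.
by apply: lerD; rewrite ler_pM2l // lerBlDr.
Qed.

Lemma nonreal_prod_lower_bound (C : numClosedFieldType) (s : seq C) :
  {in s, forall z, z \isn't Num.real} ->
  exists2 e : C, 0 < e & {in Num.real &, forall x y,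
    e * (`|x| + `|y|) ^+ size s <= `|\prod_(z <- s) (x - z * y)|}.
Proof.
elim: s => [|z s IHs] s_nreal.
  by exists 1 => // x y _ _; rewrite big_nil normr1 mulr1.
have [e1 e1_gt0 le_e1] := nonreal_linear_lower_bound (s_nreal z (mem_head _ _)).
have [t ts|e2 e2_gt0 le_e2] := IHs; first by rewrite s_nreal // inE ts orbT.
exists (e1 * e2) => [|x y xR yR]; first by rewrite mulr_gt0.
rewrite big_cons normrM exprS mulrACA ler_pM ?le_e1 ?le_e2 //.
  by rewrite mulr_ge0 ?addr_ge0 // ltW.
by rewrite mulr_ge0 ?exprn_ge0 ?addr_ge0 // ltW.
Qed.

(** * Real roots of polynomials nonnegative on the rationals *)

(* At a simple real root, [p] changes sign between the rationals
   [(floor (a n) - 1) / n] and [(floor (a n) + 1) / n] for large [n]. *)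
Lemma real_root_nonneg_double (C : archiClosedFieldType) (p : {poly C}) (a : C) :
  (forall (k : int) (n : nat), (0 < n)%N -> 0 <= p.[k%:~R / n%:R]) ->
  a \is Num.real -> root p a -> exists r, p = r * ('X - a%:P) ^+ 2.
Proof.
move=> p_ge0 aR /factor_theorem[q pE].
have [/factor_theorem[r qE]|q_a] := boolP (root q a).
  by exists r; rewrite pE qE expr2 mulrA.
(* [l] is the difference quotient of [q] at [a]; its bound [M] on the disk of radius 2 around [a]
   will act as a Lipschitz constant. *)
set c := q.[a]; have /factor_theorem[l lE] : root (q - c%:P) a.
  by rewrite /root hornerD hornerN hornerC subrr.
have qE t : q.[t] = l.[t] * (t - a) + c.
  by rewrite -[q](subrK c%:P) lE !hornerE.
have [M0 M0P] := poly_disk_bound l (`|a| + 2).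
set M := `|M0| + 1.
have M_gt0 : 0 < M by rewrite ltr_wpDl.
have MP t : `|t - a| <= 2 -> `|l.[t]| <= M.
  move=> ta; rewrite (le_trans (M0P t _)) //.
    by rewrite -[t](subrK a) addrC (le_trans (ler_normD _ _)) // lerD2l.
  rewrite (le_trans (real_ler_norm _)) ?lerDl //.
  rewrite ger0_real // (le_trans (normr_ge0 l.[a])) // M0P //.
  by rewrite lerDl.
have c_gt0 : 0 < `|c| by rewrite normr_gt0.
set n := (Num.bound (6 * M / `|c|)).+1.
have n_gt0 : 0 < n%:R :> C by rewrite ltr0n.
have n_big : 6 * M / n%:R < `|c|.
  rewrite ltr_pdivrMr // [ltRHS]mulrC -ltr_pdivrMr //.
  rewrite (lt_trans (archi_boundP _)) ?ltr_nat //.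
  by rewrite divr_ge0 ?mulr_ge0 ?ltW.
set k := Num.floor (a * n%:R).
have anR : a * n%:R \is Num.real by rewrite realM ?realn.
have /andP[k_le k_gt] := real_floor_itv anR; rewrite -/k in k_le k_gt.
pose u : C := (k - 1)%:~R / n%:R; pose v : C := (k + 1)%:~R / n%:R.
have ua : u < a.
  by rewrite ltr_pdivrMr // (lt_le_trans _ k_le) // ltr_int ltrBlDr ltrDl.
have av : a < v by rewrite ltr_pdivlMr.
have a_u : a - u <= 2 / n%:R.
  rewrite ler_pdivlMr // mulrBl divfK ?gt_eqF // lerBlDr.
  rewrite (le_trans (ltW k_gt)) // -[2]/(2%:~R) -intrD.
  by rewrite (_ : 2 + (k - 1) = k + 1) //; ring.
have v_a : v - a <= 2 / n%:R.
  rewrite ler_pdivlMr // mulrBl divfK ?gt_eqF // lerBlDr.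
  by rewrite -lerBlDl (le_trans _ k_le) // -[2]/(2%:~R) -intrB ler_int lerBlDr lerD2l.
have n2 : 2 / n%:R <= 2 :> C.
  by rewrite ler_pdivrMr // ler_peMr // ler1n.
have near t : `|t - a| <= 2 / n%:R -> `|q.[t] - c| <= 2 * M / n%:R.
  move=> ta; rewrite qE addrK normrM [2 * M]mulrC -mulrA ler_pM ?MP //.
  exact: le_trans n2.
have nu : `|q.[u] - c| <= 2 * M / n%:R.
  by rewrite near // ltr0_norm ?opprB ?subr_lt0.
have nv : `|q.[v] - c| <= 2 * M / n%:R.
  by rewrite near // gtr0_norm ?subr_gt0.
(* Since p(t) = q(t) (t - a) is nonnegative at [u] and [v], q(t) takes the sign of t - a there. *)
have qv_ge0 : 0 <= q.[v].
  have := p_ge0 (k + 1) n isT; rewrite pE -/v hornerM !hornerE.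
  by rewrite pmulr_lge0 ?subr_gt0.
have qu_le0 : q.[u] <= 0.
  have := p_ge0 (k - 1) n isT; rewrite pE -/u hornerM !hornerE.
  by rewrite nmulr_lge0 ?subr_lt0.
(* [c] is not known to be real, so norms replace signs: q(v) is at most q(v) - q(u), hence at most 4
   M / n, and [c] is within 2 M / n of q(v). *)
suff : `|c| <= 6 * M / n%:R by move/le_lt_trans/(_ n_big); rewrite ltxx.
have -> : 6 * M / n%:R = 2 * M / n%:R + (2 * M / n%:R + 2 * M / n%:R) by ring.
rewrite -[c](subKr q.[v]) addrC (le_trans (ler_normD _ _)) // lerD ?normrN //.
rewrite (ger0_norm qv_ge0).
have : q.[v] <= `|q.[v] - q.[u]|.
  by rewrite ger0_norm ?subr_ge0 ?lerDl ?oppr_ge0 // (le_trans qu_le0).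
move/le_trans; apply; rewrite -[_ - q.[u]](subrKA c).
by rewrite (le_trans (ler_normD _ _)) // lerD // distrC.
Qed.

(** * The terms of lower degree *)

(** For integers, |x| + |y| > 0 means |x| + |y| >= 1, so its powers increase with the exponent and
    the top one dominates. *)
Lemma meval2_bound n (p : {mpoly int[2]}) : (msize p <= n.+1)%N ->
  exists K : int, forall x y : int, 0 < `|x| + `|y| ->
    `|eval2 p x y| <= K * (`|x| + `|y|) ^+ n.
Proof.
move=> sp; exists (\sum_(m <- msupp p) `|p@_m|) => x y.
set s := `|x| + `|y| => s_gt0; rewrite /eval2 mevalE big_distrl /=.
rewrite (le_trans (ler_norm_sum _ _ _)) // big_seq [leRHS]big_seq.
apply: ler_sum => m m_p; rewrite normrM ler_wpM2l //.
rewrite big_ord_recl big_ord1 normrM !normrX !(tnth_nth 0) /=.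
have xs : `|x| <= s by rewrite lerDl.
have ys : `|y| <= s by rewrite lerDr.
have le_mn : (m ord0 + m (lift ord0 ord0) <= n)%N.
  have := msize_mdeg_lt m_p; rewrite mdegE big_ord_recl big_ord1.
  by move=> h; rewrite -ltnS (leq_trans h).
apply: (@le_trans _ _ (s ^+ (m ord0 + m (lift ord0 ord0)))).
  by rewrite exprD ler_pM ?exprn_ge0 ?lerXn2r ?nnegrE // ltW.
by rewrite ler_weXn2l.
Qed.

Lemma msize_sub_pihomog (R : nzRingType) d k (p : {mpoly R[k]}) :
  (msize p <= d.+1)%N -> (msize (p - pihomog mdeg d p) <= d)%N.
Proof.
move=> sp; rewrite {1}[p]mpolyE pihomogE (bigID (fun m => mdeg m == d)) /=.
rewrite addrAC subrr add0r (leq_trans (msize_sum _ _ _)) // big_seq_cond.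
apply/bigmax_leqP_seq => m _ /andP[m_p m_d].
rewrite (leq_trans (msizeZ_le _ _)) // msizeX ltn_neqAle m_d -ltnS.
exact: leq_trans (msize_mdeg_lt m_p) sp.
Qed.

(** * Square-freeness in terms of the dehomogenized polynomial *)

Lemma squarefree_form_linear (G : {mpoly int[2]}) (a b : algC) r :
  squarefree_form G -> (a, b) != (0, 0) ->
  map_mpoly intr G <> (a *: 'X_ord0 + b *: 'X_ord_max) ^+ 2 * r.
Proof.
move=> sqf ab0 GE; apply: (sqf (a *: 'X_ord0 + b *: 'X_ord_max)); last by exists r.
  by apply: (@homogE _ _ _ 1); rewrite rpredD // rpredZ // dhomogX /= mdeg1.
rewrite ltnNge; apply: contra ab0 => /msize1_polyC/mpolyP qC.
have := qC U_(ord0)%MM; have := qC U_(ord_max)%MM.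
rewrite !mcoeffD !mcoeffZ !mcoeffXU !mcoeffC !mnm1_eq0 /= !mulr0 !mulr1.
by rewrite addr0 add0r => -> ->.
Qed.

(** A double zero on the projective line lies either at infinity, where y^2 divides the form once
    [g] has degree at most n, or at a finite point a, where (x - a y)^2 divides it. *)
Lemma squarefree_hform n (g : {poly int}) :
  (size g <= n.+3)%N ->
  squarefree_form (hform n.+2 (map_poly (@mpolyC 2 int) g) 'X_ord0 'X_ord_max) ->
  (n.+1 < size g)%N /\
  forall (a : algC) r, map_poly intr g <> r * ('X - a%:P) ^+ 2.
Proof.
set G := hform _ _ _ _ => sg sqf.
have GE : map_mpoly intr G =
    hform n.+2 (map_poly (@mpolyC 2 algC) (map_poly intr g)) 'X_ord0 'X_ord_max.
  rewrite rmorph_hform /= !map_mpolyX; congr hform.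
  by apply/polyP => i; rewrite !coef_map /= map_mpolyC.
split=> [|a r gE].
  rewrite ltnNge; apply/negP => sg1.
  apply: (squarefree_form_linear (a := 0) (b := 1) sqf).
    by rewrite xpair_eqE oner_eq0 andbF.
  have sg' : (size (map_poly (@mpolyC 2 algC) (map_poly intr g)) <= n.+1)%N.
    by rewrite (leq_trans (size_poly _ _)) // (leq_trans (size_poly _ _)).
  rewrite GE !hformS // ?(leq_trans sg') // scale0r add0r scale1r expr2 -mulrA.
  reflexivity.
apply: (squarefree_form_linear (a := 1) (b := - a) sqf).
  by rewrite xpair_eqE oner_eq0.
have sr : (size (map_poly (@mpolyC 2 algC) r) <= n.+1)%N.
  rewrite (leq_trans (size_poly _ _)) //.
  have [-> | r0] := eqVneq r 0; first by rewrite size_poly0.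
  have : (size (map_poly (intr : int -> algC) g) <= n.+3)%N.
    exact: leq_trans (size_poly _ _) sg.
  rewrite gE size_Mmonic ?monic_exp ?monicXsubC // size_exp_XsubC.
  by rewrite !addnS addn0.
rewrite GE gE rmorphM rmorphXn /= map_polyXsubC expr2 mulrA.
rewrite hformMXsubC ?hformMXsubC //; last first.
  by rewrite (leq_trans (size_polyMleq _ _)) // size_XsubC addn2.
rewrite scale1r scaleNr -mul_mpolyC expr2 -mulrA.
reflexivity.
Qed.

(** * Counting values under quintic growth *)

(** Pigeonhole: the values D1 m + D2 with m at most [N] are [N.+1] distinct integers below B^5 in
    absolute value, so all of them would be taken on a square with only [N] points. *)
Lemma quintic_growth_incomplete (f : int -> int -> int) (D1 D2 : int) (B0 : nat) :
  0 < D1 ->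
  (forall x y, (B0 <= `|x| + `|y|)%N -> ((`|x| + `|y|) ^ 5 <= `|f x y|)%N) ->
  ~ (forall m : int, 0 <= m -> exists x y, f x y = D1 * m + D2).
Proof.
move=> D1_gt0 f_big f_onto.
(* The values in question are at most K N in size. As [N] is at most 9 B^2 and [B] exceeds 9 K, this
   is less than B^5. *)
pose K := (`|D1| + `|D2|)%N; pose B := (B0 + 9 * K).+1.
pose N := ((2 * B).+1 * (2 * B).+1)%N.
pose vals := [seq D1 * m%:Z + D2 | m <- iota 0 N.+1].
pose side := [seq i%:Z - B%:Z | i <- iota 0 (2 * B).+1].
have memside (x : int) : (`|x| < B)%N -> x \in side.
  move=> xB; apply/mapP; exists `|(x + B%:Z)%R|%N; last by lia.
  by rewrite mem_iota; lia.
have uvals : uniq vals.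
  by rewrite map_inj_uniq ?iota_uniq // => i j /addIr /(mulfI (lt0r_neq0 D1_gt0)) [].
have : {subset vals <= [seq f x y | x <- side, y <- side]}.
  move=> v /mapP[m]; rewrite mem_iota add0n ltnS => m_le vE.
  have [x [y fxy]] := f_onto m%:Z isT.
  have lt_xy : (`|x| + `|y| < B)%N.
    rewrite ltnNge; apply/negP => B_le.
    have /f_big : (B0 <= `|x| + `|y|)%N by rewrite (leq_trans _ B_le) // /B; lia.
    rewrite fxy leqNgt => /negP[].
    apply: (@leq_trans (B ^ 5)); last by rewrite leq_exp2r.
    have v_le : (`|(D1 * m%:Z + D2)%R| <= K * N)%N.
      apply: (@leq_trans (`|D1| * m + `|D2|)%N).
        by have := abszM D1 m; move: (D1 * m%:Z) => t; lia.
      by rewrite mulnDl leq_add ?leq_mul ?leq_pmulr.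
    apply: (leq_ltn_trans v_le).
    have N_le : (N <= 9 * B ^ 2)%N by rewrite /N; nia.
    have B3 : (9 * K < B ^ 3)%N.
      apply: (@leq_trans B); first by rewrite /B; lia.
      by rewrite -{1}[B]expn1 leq_pexp2l.
    rewrite (leq_ltn_trans (leq_mul (leqnn K) N_le)) //.
    by rewrite mulnCA mulnA (_ : 5 = 3 + 2)%N // expnD ltn_pmul2r.
  rewrite vE -fxy; apply: allpairs_f; apply: memside; lia.
move/(uniq_leq_size uvals).
by rewrite size_allpairs !size_map !size_iota ltnn.
Qed.

(** * Sign and size of the leading form *)

Lemma eval2_hform (R : comNzRingType) n (g : {poly R}) (x y : R) :
  eval2 (hform n (map_poly (@mpolyC 2 R) g) 'X_ord0 'X_ord_max) x y =
  hform n g x y.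
Proof.
rewrite /eval2 rmorph_hform /= !mevalXU; congr hform.
by apply/polyP => i; rewrite !coef_map /= mevalC.
Qed.

Lemma hformMl (S : comNzRingType) n (p : {poly S}) (t x y : S) :
  hform n p (t * x) (t * y) = t ^+ n * hform n p x y.
Proof.
rewrite /hform big_distrr /=; apply: eq_bigr => i _.
have -> : t ^+ n = t ^+ i * t ^+ (n - i) by rewrite -exprD subnKC ?leq_ord.
by rewrite !exprMn; ring.
Qed.

(** On the ray through a point where the form is negative, its degree n + 1 beats the error of
    degree n and drives [f] below any bound. *)
Lemma leading_form_nonneg n (h : {poly int}) (f : int -> int -> int) (K D : int) :
  (forall x y, 0 < `|x| + `|y| ->
    `|f x y - hform n.+1 h x y| <= K * (`|x| + `|y|) ^+ n) ->
  (forall x y, D <= f x y) ->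
  forall x y, 0 <= hform n.+1 h x y.
Proof.
move=> f_near f_ge x y; rewrite leNgt; apply/negP => h_lt0.
have [s0|s_gt0] := leP (`|x| + `|y|) 0.
  have [x0 y0] : x = 0 /\ y = 0 by lia.
  move: h_lt0; rewrite x0 y0 -[X in hform _ _ X _](mul0r 0).
  by rewrite -[X in hform _ _ _ X](mul0r 0) hformMl exprS !mul0r ltxx.
(* This [t] makes K s^n - t at most -1 - |D|, and multiplying by t^n >= 1 keeps it below [D]. *)
set s := `|x| + `|y| in s_gt0; set t := 1 + `|K * s ^+ n| + `|D|.
have t_gt0 : 0 < t by rewrite /t; lia.
have := f_near (t * x) (t * y).
rewrite hformMl !normrM -mulrDr -/s (gtr0_norm t_gt0) mulr_gt0 // => /(_ isT).
rewrite exprMn mulrCA exprS => /(le_trans (ler_norm _)).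
have := f_ge (t * x) (t * y); set w := f _ _ => D_le.
rewrite lerBlDr => w_le.
have tn_gt0 : 1 <= t ^+ n by rewrite exprn_ege1 // /t; lia.
have {}w_le : w <= t ^+ n * (K * s ^+ n - t).
  apply: le_trans w_le _; rewrite mulrBr lerD2l // [t * _]mulrC -mulrA.
  rewrite -mulrN ler_pM2l ?(lt_le_trans _ tn_gt0) //.
  have : hform n.+1 h x y <= -1 by lia.
  by rewrite -(ler_pM2l t_gt0) mulrN1.
have : t ^+ n * (K * s ^+ n - t) <= 1 * (K * s ^+ n - t).
  by rewrite ler_wnM2r // /t; lia.
by move: w_le D_le; rewrite mul1r /t; lia.
Qed.

Lemma form_lower_bound_quintic (h : {poly int}) (f : int -> int -> int)
    (K : int) (c : algC) :
  (forall x y, 0 < `|x| + `|y| ->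
    `|f x y - hform 6 h x y| <= K * (`|x| + `|y|) ^+ 5) ->
  0 < c ->
  (forall x y : int, c * (`|x| + `|y|)%:~R ^+ 6 <= `|hform 6 h x y|%:~R) ->
  exists B0 : nat, forall x y,
    (B0 <= `|x| + `|y|)%N -> ((`|x| + `|y|) ^ 5 <= `|f x y|)%N.
Proof.
move=> f_near c_gt0 h_big.
(* From here on c s >= K + 1, so the form, at least c s^6, exceeds the error K s^5 by s^5 or more.
   The successor ensures s > 0. *)
exists (Num.bound (`|K + 1|%:~R / c)).+1 => x y le_s.
have s_gt0 : 0 < `|x| + `|y| by lia.
set s := `|x| + `|y| in s_gt0.
have sE : s = (`|x| + `|y|)%N :> int by [].
have K_le : (K + 1)%:~R <= c * s%:~R.
  rewrite mulrC -ler_pdivrMr //.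
  have /archi_boundP/ltW bnd : 0 <= `|K + 1|%:~R / c :> algC.
    by rewrite divr_ge0 ?ler0z // ltW.
  apply: (le_trans _ (le_trans bnd _)).
    by rewrite ler_pM2r ?invr_gt0 // ler_int ler_norm.
  by rewrite sE -pmulrn ler_nat ltnW.
have h_ge : (K + 1) * s ^+ 5 <= `|hform 6 h x y|.
  rewrite -(ler_int algC) (le_trans _ (h_big x y)) // -/s intrM rmorphXn /=.
  by rewrite [in leRHS]exprS [leRHS]mulrA ler_wpM2r // exprn_ge0 // ler0z ltW.
have := f_near x y s_gt0; rewrite -/s => f_nr.
suff : s ^+ 5 <= `|f x y| by rewrite sE; lia.
by move: (s ^+ 5) (f x y) (hform 6 h x y) h_ge f_nr => *; lia.
Qed.

(** * Combination for polynomials of degree 6 *)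

Theorem proposition1p6 (F : {mpoly int[2]})
    (degF : msize F = 7%N)
    (sqfF6 : squarefree_form (pihomog mdeg 6 F)) :
  ~ arithmetically_complete F.
Proof.
case=> D1 [D2 [D1_gt0 FE]].
have F_ge x y : D2 <= eval2 F x y.
  have [|m [m_ge0 ->]] := (FE (eval2 F x y)).1; first by exists x, y.
  by rewrite lerDr mulr_ge0 // ltW.
have F_onto m : 0 <= m -> exists x y, eval2 F x y = D1 * m + D2.
  by move=> m_ge0; apply/FE; exists m.
have [h size_h F6E] := dhomog_hform (pihomogP mdeg 6 F).
have [K F_near0] := meval2_bound (msize_sub_pihomog (d := 6) (eq_leq degF)).
have F_near x y : 0 < `|x| + `|y| ->
    `|eval2 F x y - hform 6 h x y| <= K * (`|x| + `|y|) ^+ 5.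
  by move/F_near0; rewrite {1}/eval2 mevalB F6E -!/(eval2 _ _ _) eval2_hform.
rewrite F6E in sqfF6.
have [gt_h h_simple] := squarefree_hform size_h sqfF6.
have h_ge0 := leading_form_nonneg F_near F_ge.
pose p : {poly algC} := map_poly intr h.
have size_p : size p = size h.
  apply: size_map_poly_id0.
  by rewrite intr_eq0 lead_coef_eq0 -size_poly_gt0 (leq_trans _ gt_h).
have pE (x y : int) : (hform 6 h x y)%:~R = hform 6 p x%:~R y%:~R.
  exact: (rmorph_hform (intr : {rmorphism int -> algC})).
(* n^6 p(k/n) is the value of the form at the integer point (k, n). *)
have p_ge0 (k : int) (n : nat) : (0 < n)%N -> 0 <= p.[k%:~R / n%:R].
  move=> n_gt0; have n0 : 0 < n%:R ^+ 6 :> algC by rewrite exprn_gt0 ?ltr0n.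
  rewrite -(pmulr_rge0 _ n0) -hform_horner ?size_p ?pnatr_eq0 -?lt0n //.
  by rewrite pmulrn -pE ler0z.
(* Otherwise [y] divides the form, and swapping the variables turns the point at
   infinity into the real root 0. *)
have size_p7 : size p = 7%N.
  apply/eqP; rewrite eqn_leq {1}size_p size_h ltnNge /=; apply/negP => size_p6.
  pose q := \poly_(i < 7) p`_(6 - i).
  have q0 : root q 0 by rewrite /root horner_coef0 coef_poly nth_default.
  have q_ge0 (k : int) (n : nat) : (0 < n)%N -> 0 <= q.[k%:~R / n%:R].
    move=> n_gt0; have n0 : 0 < n%:R ^+ 6 :> algC by rewrite exprn_gt0 ?ltr0n.
    rewrite -(pmulr_rge0 _ n0) -hform_horner ?size_poly ?pnatr_eq0 -?lt0n //.
    by rewrite -hform_swap pmulrn -pE ler0z.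
  have [r qE] := real_root_nonneg_double q_ge0 (real0 _) q0.
  (* The linear coefficient of [q] is the coefficient of degree 5 of [p]. The double root 0 kills
     it, leaving [p] of degree at most 4, against [gt_h]. *)
  have p5 : p`_5 = 0.
    by have := congr1 (fun u : {poly algC} => u`_1) qE;
      rewrite coef_poly subr0 coefMXn.
  move: gt_h; rewrite -size_p ltnNge => /negP[].
  apply/leq_sizeP => -[|[|[|[|[|[|j]]]]]] // _.
  by rewrite nth_default // (leq_trans size_p6).
have [s ps] := closed_field_poly_normal p.
have lc0 : lead_coef p != 0 by rewrite lead_coef_eq0 -size_poly_gt0 size_p7.
have size_s : size s = 6%N.
  by apply: succn_inj; rewrite -size_p7 ps size_scale // size_prod_XsubC.
have s_nreal : {in s, forall z, z \isn't Num.real}.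
  (* A real root would be double by nonnegativity, which [h_simple] excludes. *)
  move=> z zs; apply/negP => zR.
  have [|r /h_simple //] := real_root_nonneg_double p_ge0 zR.
  by rewrite ps rootZ // root_prod_XsubC.
have [e e_gt0 e_le] := nonreal_prod_lower_bound s_nreal.
have [||B0 B0P] := form_lower_bound_quintic (c := `|lead_coef p| * e) F_near.
- by rewrite mulr_gt0 // normr_gt0.
- move=> x y.
  have := hform_prod_XsubC (lead_coef p) s x%:~R y%:~R.
  rewrite size_s -ps intr_norm pE => ->.
  rewrite normrM -mulrA ler_pM2l ?normr_gt0 // rmorphD /= !intr_norm -size_s.
  by apply: e_le; rewrite realz.
exact: quintic_growth_incomplete D1_gt0 B0P F_onto.
Qed.
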